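(* Let $\mathfrak{C}$ be an $(\!(n,k)\!)$ code, i.e. a $2^k$-dimensional subspace of the $n$-qubit Hilbert space $(\mathbb{C}^2)^{\otimes n}$ with $k<n$, and let $d\ge 1$ and $\delta\ge 0$. Let $\varepsilon_{\mathsf g}(\mathfrak{C},d)$ be its subsystem variance with respect to the complete graph $\mathsf g$ on the $n$ qubits (so the maximum is over all sets of at most $d$ qubits). If $\varepsilon_{\mathsf g}(\mathfrak{C},d)+\delta<1$ and $$H_2\!\left(\tfrac{\varepsilon_{\mathsf g}(\mathfrak{C},d)}{2}+\tfrac{\delta}{2}\right)<\frac{k}{n},$$ then every code state $|\psi\rangle\in\mathfrak{C}$ satisfies $\mathscr{C}^{\delta}(\psi)>\log d$, where $\mathscr{C}^\delta$ is the $\delta$-robust all-to-all circuit complexity.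
   Context: Logarithms are base 2 and $H_2(p)=-p\log p-(1-p)\log(1-p)$. For an $(\!(n,k)\!)$ code $\mathfrak{C}$, let $\Gamma=\Pi/2^k$ be the maximally mixed state on $\mathfrak{C}$ ($\Pi$ the projector onto $\mathfrak{C}$). For an adjacency graph $\mathsf G$ on the qubits, the subsystem variance is $\varepsilon_{\mathsf G}(\mathfrak{C},d)=\max\{\|\psi_S-\Gamma_S\|_1 : |\psi\rangle\in\mathfrak{C}\text{ a unit vector}, S\text{ a set of qubits connected in }\mathsf G, |S|\le d\}$, where subscript $S$ denotes the reduced state on $S$ and $\psi=|\psi\rangle\langle\psi|$. The circuit complexity $\mathscr{C}_{\mathsf G}(\psi)$ of a pure state is the minimum $l$ such that $|\psi\rangle=U_l\cdots U_1|0\rangle^{\otimes n}$, where each $U_i$ is a tensor product of 2-qubit unitaries acting on disjoint pairs of qubits that are adjacent in $\mathsf G$. The $\delta$-robust complexity $\mathscr{C}^\delta_{\mathsf G}(\psi)$ is the minimum of $\mathscr{C}_{\mathsf G}(\psi')$ over pure states $\psi'$ with $\|\psi'-\psi\|_1\le\delta$. ''All-to-all'' means $\mathsf G$ is the complete graph $\mathsf g$, and then $\mathscr{C}^\delta=\mathscr{C}^\delta_{\mathsf g}$. *)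

(* Defs.v *)
From HB Require Import structures.
From mathcomp Require Import all_boot all_order all_algebra.
From mathcomp Require Import spectral complex.
From mathcomp Require Import all_classical reals ereal exp.

Set Implicit Arguments.
Unset Strict Implicit.
Unset Printing Implicit Defensive.

Import Order.TTheory GRing.Theory Num.Theory.
Local Open Scope ring_scope.

(** Computational basis of n qubits: bit strings 'I_n -> bool.
    Operators on the Hilbert space spanned by a finite basis T are
    matrices 'M[R[i]]_#|T| (rows/columns indexed through enum_rank). *)
Definition qbasis (n : nat) := {ffun 'I_n -> bool}.

Definition entry {C : Type} {T : finType} (A : 'M[C]_#|T|) (x y : T) : C :=
  A (enum_rank x) (enum_rank y).

Definition mkop {C : Type} {T : finType} (f : T -> T -> C) : 'M[C]_#|T| :=
  \matrix_(i, j) f (enum_val i) (enum_val j).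

Definition adj {C : numClosedFieldType} {m p : nat} (A : 'M[C]_(m, p)) :
  'M[C]_(p, m) := (map_mx Num.conj A)^T.

Definition dens {C : numClosedFieldType} {m : nat} (v : 'cV[C]_m) : 'M[C]_m :=
  v *m adj v.

Definition unit_vec {C : numClosedFieldType} {m : nat} (v : 'cV[C]_m) : Prop :=
  (adj v *m v) 0 0 = 1.

(** Trace norm ||A||_1 = Tr sqrt(A^dagger A) = sum of the square roots of
    the eigenvalues (with multiplicity) of the positive semidefinite (hence
    normal) matrix A^dagger A, given by its spectral decomposition. *)
Definition trnorm {R : rcfType} {m : nat} (A : 'M[R[i]]_m) : R :=
  complex.Re (\sum_(j < m) sqrtC (spectral_diag (adj A *m A) 0 j)).

Definition subbasis (n : nat) (S : {set 'I_n}) :=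
  {ffun {i : 'I_n | i \in S} -> bool}.

Definition restrict (n : nat) (S : {set 'I_n}) (x : qbasis n) : subbasis S :=
  [ffun i => x (val i)].

Definition ptrace {C : numClosedFieldType} (n : nat) (S : {set 'I_n})
  (rho : 'M[C]_#|qbasis n|) : 'M[C]_#|subbasis S| :=
  mkop (fun a b : subbasis S =>
    \sum_(x : qbasis n | restrict S x == a)
      \sum_(y : qbasis n | (restrict S y == b) &&
                           [forall i, (i \notin S) ==> (x i == y i)])
        entry rho x y).

(** Pi is the orthogonal projector onto an ((n,k)) code (a 2^k-dimensional
    subspace of the n-qubit space): Hermitian, idempotent, of rank 2^k. *)
Definition code_projector {R : rcfType} (n k : nat)
  (Pi : 'M[R[i]]_#|qbasis n|) : Prop :=
  [/\ adj Pi = Pi, Pi *m Pi = Pi & \rank Pi = (2 ^ k)%N].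

Definition in_code {R : rcfType} (n : nat) (Pi : 'M[R[i]]_#|qbasis n|)
  (psi : 'cV[R[i]]_#|qbasis n|) : Prop := Pi *m psi = psi.

Definition Gamma {R : rcfType} (n k : nat) (Pi : 'M[R[i]]_#|qbasis n|) :
  'M[R[i]]_#|qbasis n| := ((2 ^ k)%:R)^-1 *: Pi.

Definition complete_graph (n : nat) : rel 'I_n := fun i j => i != j.
Arguments complete_graph n : clear implicits.

Definition connected_in (n : nat) (G : rel 'I_n) (S : {set 'I_n}) : Prop :=
  forall x y, x \in S -> y \in S ->
    connect [rel a b | [&& G a b, a \in S & b \in S]] x y.

(** Subsystem variance eps_G(C, d): the maximum (= supremum, the set being
    compact) of ||psi_S - Gamma_S||_1. *)
Definition subsystem_variance {R : realType} (n k : nat) (G : rel 'I_n)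
  (Pi : 'M[R[i]]_#|qbasis n|) (d : nat) : R :=
  sup [set r : R | exists (psi : 'cV[R[i]]_#|qbasis n|) (S : {set 'I_n}),
        [/\ unit_vec psi, in_code Pi psi, connected_in G S, (#|S| <= d)%N &
            r = trnorm (ptrace S (dens psi) - ptrace S (Gamma k Pi))]].

(** One circuit layer: a tensor product of 2-qubit unitaries u p acting on
    disjoint pairs p = (p.1, p.2) of G-adjacent qubits (identity on the
    uncovered qubits).  The 2-qubit space has basis bool * bool, the first
    component being the bit of qubit p.1. *)
Definition covered (n : nat) (M : seq ('I_n * 'I_n)) : seq 'I_n :=
  flatten [seq [:: p.1; p.2] | p <- M].

Definition is_layer {R : rcfType} (n : nat) (G : rel 'I_n)
  (L : 'M[R[i]]_#|qbasis n|) : Prop :=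
  exists (M : seq ('I_n * 'I_n))
         (u : 'I_n * 'I_n -> 'M[R[i]]_#|{: bool * bool}|),
    [/\ uniq (covered M),
        (forall p, p \in M -> G p.1 p.2),
        (forall p, p \in M -> u p \is unitarymx) &
        L = mkop (fun x y : qbasis n =>
              (\prod_(p <- M) entry (u p) (x p.1, x p.2) (y p.1, y p.2)) *
              ([forall i, (i \notin covered M) ==> (x i == y i)])%:R)].

Definition ket0 {R : rcfType} (n : nat) : 'cV[R[i]]_#|qbasis n| :=
  \col_j (enum_val j == [ffun => false])%:R.

Definition reachable {R : rcfType} (n : nat) (G : rel 'I_n) (l : nat)
  (v : 'cV[R[i]]_#|qbasis n|) : Prop :=
  exists Ls : seq 'M[R[i]]_#|qbasis n|,
    [/\ size Ls = l, (forall L, L \in Ls -> is_layer G L) &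
        v = foldr (fun L w => L *m w) (@ket0 R n) Ls].

(** Circuit complexity of a pure state rho = |psi><psi| (minimum, +oo if
    no circuit exists), and its delta-robust version. *)
Definition circuit_complexity {R : realType} (n : nat) (G : rel 'I_n)
  (rho : 'M[R[i]]_#|qbasis n|) : \bar R :=
  ereal_inf [set x : \bar R | exists (l : nat) (v : 'cV[R[i]]_#|qbasis n|),
               rho = dens v /\ reachable G l v /\ x = (l%:R)%:E].

Definition robust_complexity {R : realType} (n : nat) (G : rel 'I_n)
  (delta : R) (rho : 'M[R[i]]_#|qbasis n|) : \bar R :=
  ereal_inf [set x : \bar R | exists v : 'cV[R[i]]_#|qbasis n|,
               [/\ unit_vec v, trnorm (dens v - rho) <= delta &
                   x = circuit_complexity G (dens v)]].

Definition log2 {R : realType} (x : R) : R := ln x / ln 2.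

Definition H2 {R : realType} (p : R) : R :=
  - p * log2 p - (1 - p) * log2 (1 - p).

(* Main.v *)
Require Import Defs.
From HB Require Import structures.
From mathcomp Require Import all_boot all_order all_algebra.
From mathcomp Require Import spectral complex.
From mathcomp Require Import all_classical reals ereal exp.
From mathcomp Require Import ring lra.
Import Order.TTheory GRing.Theory Num.Theory.
Local Open Scope ring_scope.
Set Implicit Arguments.
Unset Strict Implicit.
Unset Printing Implicit Defensive.

(** Suppose a circuit [U] of depth [l] with [2 ^ l <= d] prepares a state within
    [delta] of a code state.  The observable [W_i = U Z_i U^dagger] is unitary
    and supported on the light cone of qubit [i], which has at most [2 ^ l]
    qubits, so [|tr (A W)| <= ||A||_1], used on the light cone for the variance
    and globally for [delta], gives [tr (Gamma W_i) >= 1 - eps - delta].  Hence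
    measuring [U^dagger Gamma U] in the computational basis yields a bit string
    each of whose bits is 1 with probability at most [q = (eps + delta) / 2].
    Every outcome has probability at most [2 ^ - k], as [Gamma] is a projector
    divided by [2 ^ k], and comparing with independent Bernoulli([q]) bits gives
    [k <= n H2(q)], contrary to the hypothesis. *)

(** * Trace norm as a bound on traces against unitaries *)

Section LinearAlgebra.
Variable C : numClosedFieldType.

Lemma adjE m p (A : 'M[C]_(m, p)) : adj A = (A ^t Num.conj)%sesqui.
Proof. by rewrite /adj map_trmx. Qed.

Lemma adjM m p q (A : 'M[C]_(m, p)) (B : 'M_(p, q)) :
  adj (A *m B) = adj B *m adj A.
Proof. by rewrite /adj map_mxM trmx_mul. Qed.

Lemma adjK m p (A : 'M[C]_(m, p)) : adj (adj A) = A.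
Proof. by apply/matrixP=> i j; rewrite !mxE conjCK. Qed.

Lemma unitary_mul_adj m (U : 'M[C]_m) : U \is unitarymx -> U *m adj U = 1%:M.
Proof. by rewrite adjE => /unitarymxP. Qed.

Lemma unitary_adj_mul m (U : 'M[C]_m) : U \is unitarymx -> adj U *m U = 1%:M.
Proof. by move=> /unitary_mul_adj /mulmx1C. Qed.

Lemma adj_unitary m (U : 'M[C]_m) : U \is unitarymx -> adj U \is unitarymx.
Proof. by rewrite adjE trmxC_unitary. Qed.

Lemma adj_mul_diag m p (B : 'M[C]_(m, p)) j :
  (adj B *m B) j j = \sum_i `|B i j| ^+ 2.
Proof. by rewrite mxE; apply: eq_bigr => i _; rewrite !mxE normCK mulrC. Qed.

Lemma mul_adj_diag m p (B : 'M[C]_(m, p)) j :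
  (B *m adj B) j j = \sum_i `|B j i| ^+ 2.
Proof. by rewrite mxE; apply: eq_bigr => i _; rewrite !mxE normCK. Qed.

Lemma cauchy_schwarz_sum m (a b : 'I_m -> C) :
  `|\sum_i a i * b i| <=
    sqrtC (\sum_i `|a i| ^+ 2) * sqrtC (\sum_i `|b i| ^+ 2).
Proof.
have := (CauchySchwarz_sqrt (@dotmx C m) (\row_i a i) (\row_i (b i)^*)).1.
rewrite /= !dotmxE !mxE; congr (`|_| <= sqrtC _ * sqrtC _);
  apply: eq_bigr => i _; rewrite !mxE.
- by rewrite conjCK.
- by rewrite normCK.
- by rewrite conjCK normCK mulrC.
Qed.

(** In its eigenbasis [P], [A^dagger A] becomes the Gram matrix of the columns of [A P^dagger], so
    each eigenvalue is a squared column norm. *)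
Lemma spectral_adj_mul m (A : 'M[C]_m) :
  exists2 P : 'M[C]_m, P \is unitarymx &
    forall j, spectral_diag (adj A *m A) 0 j = \sum_i `|(A *m adj P) i j| ^+ 2.
Proof.
set H := adj A *m A; exists (spectralmx H); first exact: spectral_unitarymx.
have Pu := spectral_unitarymx H.
have Hn : H \is normalmx.
  by apply/normalmxP; rewrite -!adjE /H adjM adjK.
have HE := orthomx_spectralP Hn.
set P := spectralmx H in Pu HE *; set D := spectral_diag H in HE *.
move=> j; rewrite -adj_mul_diag adjM adjK -mulmxA [adj A *m _]mulmxA -/H.
rewrite HE invmx_unitary // -adjE -!mulmxA unitary_mul_adj // mulmx1.
by rewrite mulmxA unitary_mul_adj // mul1mx !mxE eqxx mulr1n.
Qed.

(** After inserting [P^dagger P = 1] and cycling, the trace is that of [(P W) (A P^dagger)]: each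
    diagonal entry pairs a unit row with a column whose norm is the square root of an eigenvalue,
    and Cauchy-Schwarz applies. *)
Lemma normr_trace_le m (A W : 'M[C]_m) : W \is unitarymx ->
  `|\tr (A *m W)| <= \sum_j sqrtC (spectral_diag (adj A *m A) 0 j).
Proof.
move=> Wu; have [P Pu PE] := spectral_adj_mul A.
have Vu : P *m W \is unitarymx by exact: mul_unitarymx.
rewrite -[A in \tr (A *m W)]mulmx1 -(unitary_adj_mul Pu) mulmxA -mulmxA.
rewrite mxtrace_mulC /mxtrace; apply: le_trans (ler_norm_sum _ _ _) _.
apply: ler_sum => j _; rewrite PE mxE.
apply: le_trans (cauchy_schwarz_sum _ _) _.
by rewrite -[X in sqrtC X * _]mul_adj_diag unitary_mul_adj // mxE eqxx sqrtC1 mul1r.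
Qed.

(** A crude bound from [sqrt x <= 1 + x], the eigenvalues adding up to the squared Frobenius norm.
    It serves to show that the set defining the variance is bounded above. *)
Lemma spectral_sqrt_sum_le m (A : 'M[C]_m) :
  \sum_j sqrtC (spectral_diag (adj A *m A) 0 j)
    <= m%:R + \sum_i \sum_j `|A i j| ^+ 2.
Proof.
have [P Pu PE] := spectral_adj_mul A.
have sqrtC_le (x : C) : 0 <= x -> sqrtC x <= 1 + x.
  move=> x0; rewrite -[x in 1 + x]sqrtCK; set s := sqrtC x.
  have s0 : 0 <= s by rewrite sqrtC_ge0.
  have [s1|s1] : s <= 1 \/ 1 <= s.
    by case/orP: (real_leVge (ger0_real s0) (@real1 C)); [left|right].
  - by apply: le_trans s1 _; rewrite lerDl exprn_ge0.
  - by apply: (@le_trans _ _ (s ^+ 2)); [rewrite expr2 ler_peMl|rewrite lerDr].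
have -> : \sum_i \sum_j `|A i j| ^+ 2 =
    \sum_j spectral_diag (adj A *m A) 0 j.
  transitivity (\tr (A *m adj A)).
    by apply: eq_bigr => i _; rewrite mul_adj_diag.
  have -> : A *m adj A = (A *m adj P) *m adj (A *m adj P).
    by rewrite adjM adjK mulmxA -(mulmxA A) unitary_adj_mul // mulmx1.
  by rewrite mxtrace_mulC; apply: eq_bigr => j _; rewrite adj_mul_diag PE.
have -> : m%:R = \sum_(j < m) 1 :> C by rewrite sumr_const card_ord.
rewrite -big_split; apply: ler_sum => j _; apply: sqrtC_le.
by rewrite PE sumr_ge0 // => i _; rewrite exprn_ge0.
Qed.

End LinearAlgebra.

(** In a full-rank factorisation [A = c r], cancelling [c] on the left and [r] on the right of
    [c r c r = c r] leaves [r c = 1], an identity matrix of size the rank; the trace is cyclic. *)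
Lemma mxtrace_idempotent (F : fieldType) m (A : 'M[F]_m) :
  A *m A = A -> \tr A = (\rank A)%:R.
Proof.
move=> AA; rewrite -[A in LHS]mulmx_base mxtrace_mulC.
suff -> : row_base A *m col_base A = 1%:M by rewrite mxtrace1.
have /row_freeP[L rL] := row_base_free A.
have /row_fullP[K cK] := col_base_full A.
have cr := mulmx_base A.
move: (col_base A) (row_base A) rL cK cr => c r rL cK cr.
have : K *m ((c *m r) *m (c *m r)) *m L = K *m (c *m r) *m L by rewrite cr AA.
by rewrite !mulmxA cK mul1mx -!mulmxA rL mulmx1.
Qed.

Lemma normr_Re_le (R : rcfType) (z x : R[i]) :
  `|z| <= x -> `|complex.Re z| <= complex.Re x.
Proof.
by move=> zx; have := le_trans (normc_ge_Re z) zx; rewrite lecE /= => /andP[].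
Qed.

Lemma Re_trace_le_trnorm (R : rcfType) m (A W : 'M[R[i]]_m) : W \is unitarymx ->
  `|complex.Re (\tr (A *m W))| <= trnorm A.
Proof. by move=> Wu; apply: normr_Re_le; exact: normr_trace_le. Qed.

Lemma trnorm_le_sum (R : rcfType) m (A : 'M[R[i]]_m) :
  trnorm A <= complex.Re (m%:R + \sum_i \sum_j `|A i j| ^+ 2).
Proof. by have := spectral_sqrt_sum_le A; rewrite lecE => /andP[]. Qed.

(** * Operators indexed by a finite basis *)

Section Entries.
Variables (C : numClosedFieldType) (T : finType).
Implicit Types (A B : 'M[C]_#|T|) (x y : T).

Lemma entry_mkop (f : T -> T -> C) x y : entry (mkop f) x y = f x y.
Proof. by rewrite /entry /mkop mxE !enum_rankK. Qed.

Lemma op_eqP A B : (forall x y, entry A x y = entry B x y) -> A = B.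
Proof.
move=> AB; apply/matrixP=> i j.
by have := AB (enum_val i) (enum_val j); rewrite /entry !enum_valK.
Qed.

Lemma sum_enum_val (V : nmodType) (F : T -> V) :
  \sum_(i < #|T|) F (enum_val i) = \sum_x F x.
Proof.
rewrite [RHS](reindex (@enum_val T (mem T))) //=.
by exists enum_rank => x _; rewrite ?enum_valK ?enum_rankK.
Qed.

Lemma entry_mul A B x y : entry (A *m B) x y = \sum_z entry A x z * entry B z y.
Proof.
rewrite -sum_enum_val /entry mxE.
by apply: eq_bigr => i _; rewrite enum_valK.
Qed.

Lemma entry_adj A x y : entry (adj A) x y = (entry A y x)^*.
Proof. by rewrite /entry !mxE. Qed.

Lemma entry1 x y : entry (1%:M : 'M[C]_#|T|) x y = (x == y)%:R.
Proof. by rewrite /entry mxE (inj_eq enum_rank_inj). Qed.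

Lemma mxtrace_entry A : \tr A = \sum_x entry A x x.
Proof.
by rewrite -sum_enum_val; apply: eq_bigr => i _; rewrite /entry enum_valK.
Qed.

Lemma unitary_op A : adj A *m A = 1%:M -> A \is unitarymx.
Proof. by move=> /mulmx1C AA; apply/unitarymxP; rewrite -adjE. Qed.

End Entries.

(** * Operators supported on a set of qubits, and their reductions *)

Section Support.
Variables (C : numClosedFieldType) (n : nat).
Implicit Types (A B : 'M[C]_#|qbasis n|) (x y z s : qbasis n).
Implicit Types (S T : {set 'I_n}).

Definition bxor x y : qbasis n := [ffun i => x i (+) y i].

Lemma bxorK s : involutive (bxor ^~ s).
Proof. by move=> x; apply/ffunP=> i; rewrite !ffunE addbK. Qed.

Lemma bxor_bij s : bijective (bxor ^~ s).
Proof. by exists (bxor ^~ s); exact: bxorK. Qed.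

(** [A] acts as the identity outside [S]: the two clauses say that [A] commutes
    with every Pauli Z, resp. every product of Pauli X, located outside [S]. *)
Definition supported S A :=
  (forall x y i, i \notin S -> x i != y i -> entry A x y = 0) /\
  (forall x y s, (forall i, i \in S -> s i = false) ->
    entry A (bxor x s) (bxor y s) = entry A x y).

Lemma supported_sub S T A : S \subset T -> supported S A -> supported T A.
Proof.
move=> /fintype.subsetP ST [A0 As]; split=> [x y i iT|x y s sT].
- by apply: A0; apply: contra iT => /ST.
- by apply: As => i /ST /sT.
Qed.

Lemma supported_adj S A : supported S A -> supported S (adj A).
Proof.
move=> [A0 As]; split=> [x y i iS xy|x y s sS]; rewrite !entry_adj.
- by rewrite (A0 y x i) ?conjC0 // eq_sym.
- by rewrite As.
Qed.

Lemma supported_mul S A B : supported S A -> supported S B -> supported S (A *m B).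
Proof.
move=> [A0 As] [B0 Bs]; split=> [x y i iS xy|x y s sS]; rewrite !entry_mul.
- apply: big1 => z _; have [xz|xz] := eqVneq (x i) (z i).
  + by rewrite (B0 z y i) ?mulr0 // -xz.
  + by rewrite (A0 x z i) ?mul0r.
- rewrite (reindex (bxor ^~ s)) /=; last exact: onW_bij (bxor_bij s).
  by apply: eq_bigr => z _; rewrite As // Bs.
Qed.

(** With [w = x + y + z] (bitwise), the [z]-term of [(A B) x y] equals the
    [w]-term of [(B A) x y]. *)
Lemma supported_comm S T A B : [disjoint S & T] ->
  supported S A -> supported T B -> A *m B = B *m A.
Proof.
move=> ST [A0 As] [B0 Bs]; apply: op_eqP => x y; rewrite !entry_mul.
rewrite [RHS](reindex (bxor ^~ (bxor x y))) /=; last exact: onW_bij (bxor_bij _).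
apply: eq_bigr => z _.
have nS i : i \in T -> i \notin S by move=> iT; rewrite (disjointFl ST iT).
have nT i : i \in S -> i \notin T by move=> iS; rewrite (disjointFr ST iS).
case: (pickP [pred i | (i \notin S) && (x i != z i)]) => [i /andP[iS xz]|xz].
  rewrite (A0 x z i) // (A0 _ y i) ?mulr0 ?mul0r // !ffunE.
  by move: xz; case: (x i) (y i) (z i) => -[] [].
case: (pickP [pred i | (i \notin T) && (z i != y i)]) => [i /andP[iT zy]|zy].
  rewrite (B0 z y i) // (B0 x _ i) ?mulr0 ?mul0r // !ffunE.
  by move: zy; case: (x i) (y i) (z i) => -[] [].
rewrite mulrC; congr (_ * _).
- rewrite -(Bs x _ (bxor x z)).
    by congr (entry B _ _); apply/ffunP=> i; rewrite !ffunE;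
      case: (x i) (y i) (z i) => -[] [].
  move=> i iT; have := xz i; rewrite /= (nS _ iT) /= !ffunE.
  by case: (x i) (z i) => -[].
- rewrite -(As x z (bxor z y)).
    by congr (entry A _ _); apply/ffunP=> i; rewrite !ffunE;
      case: (x i) (y i) (z i) => -[] [].
  move=> i iS; have := zy i; rewrite /= (nT _ iS) /= !ffunE.
  by case: (z i) (y i) => -[].
Qed.

Definition extend S (a : subbasis S) : qbasis n :=
  [ffun i => if insub i is Some j then a j else false].

Lemma extendE S (a : subbasis S) (j : {i : 'I_n | i \in S}) :
  extend a (val j) = a j.
Proof. by rewrite ffunE valK. Qed.

Lemma extend_out S (a : subbasis S) i : i \notin S -> extend a i = false.
Proof. by move=> iS; rewrite ffunE insubN. Qed.

Lemma restrict_extend S (a : subbasis S) : Defs.restrict S (extend a) = a.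
Proof. by apply/ffunP=> j; rewrite ffunE extendE. Qed.

Lemma extend_restrict S x i : i \in S -> extend (Defs.restrict S x) i = x i.
Proof.
move=> iS; rewrite -[in LHS](SubK {i : 'I_n | i \in S} iS).
by rewrite extendE ffunE SubK.
Qed.

(** The tensor factor on [S] of a supported [A]. By the second clause of [supported], any common
    padding outside [S] would give the same entries as zeros. *)
Definition reduce S A : 'M[C]_#|subbasis S| :=
  mkop (fun a b => entry A (extend a) (extend b)).

Lemma reduce_unitary S A : supported S A -> A \is unitarymx ->
  reduce S A \is unitarymx.
Proof.
move=> [A0 As] /unitary_adj_mul AA; apply: unitary_op; apply: op_eqP => a b.
rewrite entry_mul; have := congr1 (fun M => entry M (extend a) (extend b)) AA.
rewrite /= !entry1 (inj_eq (can_inj (@restrict_extend S))) entry_mul => <-.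
(* Intermediate strings with a 1 outside [S] contribute nothing, since [A] cannot change that bit of
   [extend b]; all others have the form [extend c]. *)
rewrite [RHS](bigID [pred z | extend (Defs.restrict S z) == z]) /=.
rewrite [X in _ = _ + X]big1 ?addr0 => [|z zN]; last first.
  have [i iS zi] : exists2 i, i \notin S & z i = true.
    case: (pickP [pred i | (i \notin S) && z i]) => [i /andP[]|z0]; first by exists i.
    case/eqP: zN; apply/ffunP=> i; have [iS|iS] := boolP (i \in S).
      exact: extend_restrict.
    by rewrite extend_out //; have := z0 i; rewrite /= iS /= => ->.
  by rewrite (A0 z (extend b) i) ?mulr0 // extend_out // zi.
rewrite [RHS](reindex_onto (@extend S) (@Defs.restrict n S)) => [|z /eqP //].
rewrite [RHS](eq_bigl predT) => [|c]; last by rewrite /= restrict_extend !eqxx.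
by apply: eq_bigr => c _; rewrite !entry_adj !entry_mkop.
Qed.

(** The characteristic property of the partial trace. It lets a trace norm on the subsystem bound
    the expectation of an observable on all qubits. *)
Lemma trace_ptrace S A rho : supported S A ->
  \tr (ptrace S rho *m reduce S A) = \tr (rho *m A).
Proof.
move=> [A0 As]; rewrite !mxtrace_entry.
under eq_bigr => a _ do rewrite entry_mul.
under [RHS]eq_bigr => x _ do rewrite entry_mul.
transitivity (\sum_a \sum_b \sum_(x | Defs.restrict S x == a)
    \sum_(y | Defs.restrict S y == b) entry rho x y * entry A y x).
  apply: eq_bigr => a _; apply: eq_bigr => b _; rewrite !entry_mkop mulr_suml.
  apply: eq_bigr => x /eqP xa; rewrite mulr_suml.
  (* Pairs differing outside [S] are absent from the partial trace, and on the right they vanish by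
     the first clause of [supported]. *)
  rewrite [RHS](bigID [pred y : qbasis n |
    [forall i, (i \notin S) ==> (x i == y i)]]) /=.
  rewrite [X in _ = _ + X]big1 ?addr0 => [|y /andP[_]]; last first.
    rewrite negb_forall => /existsP[ i]; rewrite negb_imply => /andP[iS xy].
    by rewrite (A0 y x i) ?mulr0 // eq_sym.
  apply: eq_bigr => y /andP[/eqP yb /forallP xy]; congr (_ * _).
  (* Adding the bits of [x] outside [S] to both strings clears them there, which leaves [extend b]
     and [extend a]. *)
  rewrite -(As y x [ffun i => (i \notin S) && x i]) => [|i iS]; last first.
    by rewrite ffunE iS.
  congr (entry A _ _); apply/ffunP=> i; rewrite -?xa -?yb [RHS]ffunE [X in _ (+) X]ffunE.
  - have [iS|iS] := boolP (i \in S); first by rewrite extend_restrict // addbF.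
    by rewrite extend_out //; have := xy i; rewrite iS /= => /eqP->; rewrite addbb.
  - have [iS|iS] := boolP (i \in S); first by rewrite extend_restrict // addbF.
    by rewrite extend_out // addbb.
rewrite [RHS](partition_big (Defs.restrict S) xpredT) //=.
apply: eq_bigr => a _; rewrite exchange_big /=; apply: eq_bigr => x _.
by rewrite [RHS](partition_big (Defs.restrict S) xpredT).
Qed.

End Support.

(** * Layers of disjoint two-qubit gates *)

Section Layers.
Variables (C : numClosedFieldType) (n : nat).
Implicit Types (A : 'M[C]_#|qbasis n|) (x y z : qbasis n) (S : {set 'I_n}).
Implicit Types (p : 'I_n * 'I_n) (M : seq ('I_n * 'I_n)).
Implicit Types (u : 'I_n * 'I_n -> 'M[C]_#|{: bool * bool}|).

Definition layer_op M u : 'M[C]_#|qbasis n| := mkop (fun x y =>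
  (\prod_(p <- M) entry (u p) (x p.1, x p.2) (y p.1, y p.2)) *
  ([forall i, (i \notin covered M) ==> (x i == y i)])%:R).

Lemma agree_offP (V : seq 'I_n) x y :
  reflect (forall i, i \notin V -> x i = y i)
          [forall i, (i \notin V) ==> (x i == y i)].
Proof.
apply: (iffP forallP) => xy i; last by apply/implyP => /xy ->.
by have /implyP h := xy i => /h /eqP.
Qed.

Lemma covered_cons p M : covered (p :: M) = [:: p.1, p.2 & covered M].
Proof. by []. Qed.

Lemma layer_op_nil u : layer_op [::] u = 1%:M.
Proof.
apply: op_eqP => x y; rewrite entry_mkop entry1 big_nil mul1r; congr ((nat_of_bool _)%:R).
by apply/idP/eqP => [/agree_offP xy|->];
  [apply/ffunP => i; apply: xy|apply/agree_offP].
Qed.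

Lemma mem_covered p M : p \in M -> (p.1 \in covered M) && (p.2 \in covered M).
Proof.
move=> pM; apply/andP; split; apply/flattenP; exists [:: p.1; p.2];
  by rewrite ?(map_f (fun q : 'I_n * 'I_n => [:: q.1; q.2])) // !inE eqxx ?orbT.
Qed.

Lemma layer_op_cons p M u : uniq (covered (p :: M)) ->
  layer_op (p :: M) u = layer_op [:: p] u *m layer_op M u.
Proof.
rewrite covered_cons /= inE negb_or => /and3P[/andP[p12 p1M] p2M _].
apply: op_eqP => x y; rewrite entry_mul entry_mkop.
(* The only intermediate string that contributes: the gate fixes every bit outside its pair, and the
   other gates, being disjoint from it, fix the bits of the pair. *)
pose z : qbasis n := [ffun i => if i \in [:: p.1; p.2] then y i else x i].
rewrite (bigD1 z) //= [X in _ + X]big1 ?addr0 => [|w wz]; last first.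
  rewrite !entry_mkop.
  case: agree_offP => [xw|_]; last by rewrite mulr0 mul0r.
  case: agree_offP => [wy|_]; last by rewrite !mulr0.
  case/eqP: wz; apply/ffunP => i; rewrite ffunE.
  case: ifPn => ip; last by rewrite xw.
  by apply: wy; move: ip; rewrite !inE => /orP[] /eqP ->.
have zp1 : z p.1 = y p.1 by rewrite ffunE !inE eqxx.
have zp2 : z p.2 = y p.2 by rewrite ffunE !inE eqxx orbT.
have zM i : i \in covered M -> z i = x i.
  move=> iM; rewrite ffunE !inE; case: eqP => [ip|_].
    by rewrite -ip iM in p1M.
  by case: eqP => [ip|//]; rewrite -ip iM in p2M.
rewrite !entry_mkop !big_cons big_nil mulr1 zp1 zp2 -!mulrA; congr (_ * _).
have -> : [forall i, (i \notin covered [:: p]) ==> (x i == z i)].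
  by apply/agree_offP => i ip; rewrite ffunE (negPf ip).
rewrite mul1r; congr (_ * _).
  rewrite !big_seq; apply: eq_bigr => q /mem_covered /andP[q1 q2].
  by rewrite !zM.
congr ((nat_of_bool _)%:R); apply/agree_offP/agree_offP => xy i ip; last first.
  move: ip; rewrite covered_cons !inE !negb_or => /and3P[i1 i2 iM].
  by rewrite -xy // ffunE !inE (negPf i1) (negPf i2).
rewrite ffunE; case: ifPn => // ip'; apply: xy.
by rewrite covered_cons -[_ :: _]/([:: p.1; p.2] ++ _) mem_cat negb_or ip'.
Qed.

Lemma gate_supported p u : supported [set p.1; p.2] (layer_op [:: p] u).
Proof.
split=> [x y i ip xy|x y s sp]; rewrite !entry_mkop.
  case: agree_offP => [xy'|]; last by rewrite mulr0.
  by rewrite xy' ?eqxx // in xy; move: ip; rewrite !inE.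
rewrite !big_cons !big_nil !ffunE !sp ?inE ?eqxx ?orbT // !addbF.
congr (_ * (nat_of_bool _)%:R).
apply: eq_forallb => i; rewrite !ffunE.
by case: (x i) (y i) (s i) => -[] [].
Qed.

Lemma gate_unitary p u : p.1 != p.2 -> u p \is unitarymx ->
  layer_op [:: p] u \is unitarymx.
Proof.
move=> p12 /unitary_adj_mul uu; apply: unitary_op; apply: op_eqP => x y.
rewrite entry_mul entry1.
(* The strings agreeing with [x] off the pair correspond through [f] and [g] to the two bits on it,
   which reduces the claim to the unitarity of [u p]. *)
pose f (c : bool * bool) : qbasis n :=
  [ffun i => if i == p.1 then c.1 else if i == p.2 then c.2 else x i].
pose g z : bool * bool := (z p.1, z p.2).
have fp1 c : f c p.1 = c.1 by rewrite ffunE eqxx.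
have fp2 c : f c p.2 = c.2 by rewrite ffunE eqxx eq_sym (negPf p12).
have fK : cancel f g by move=> [c1 c2]; rewrite /g fp1 fp2.
have fout c i : i \notin [:: p.1; p.2] -> f c i = x i.
  by rewrite !inE negb_or => /andP[/negPf i1 /negPf i2]; rewrite ffunE i1 i2.
rewrite (bigID [pred z | f (g z) == z]) /= [X in _ + X]big1 ?addr0; last first.
  move=> z zN; rewrite entry_adj !entry_mkop.
  case: agree_offP => [zx|_]; last by rewrite mulr0 conjC0 mul0r.
  case/eqP: zN; apply/ffunP => i; rewrite ffunE.
  case: eqP => [->//|/eqP i1]; case: eqP => [->//|/eqP i2].
  by rewrite zx // !inE negb_or i1.
rewrite (reindex_onto f g) => [|z /eqP //].
rewrite (eq_bigl predT) => [|c]; last by rewrite /= fK !eqxx.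
have agreex c : [forall i, (i \notin covered [:: p]) ==> (f c i == x i)].
  by apply/agree_offP => i ip; rewrite fout.
have agreey c : [forall i, (i \notin covered [:: p]) ==> (f c i == y i)] =
    [forall i, (i \notin covered [:: p]) ==> (x i == y i)].
  by apply/agree_offP/agree_offP => xy i ip; rewrite -?xy ?fout // -(fout c).
under eq_bigr => c _ do rewrite entry_adj !entry_mkop !big_cons !big_nil
  !mulr1 agreex agreey fp1 fp2 -surjective_pairing mulr1 mulrA.
have uxy : \sum_c (entry (u p) c (g x))^* * entry (u p) c (g y) = (g x == g y)%:R.
  by rewrite -entry1 -uu entry_mul; apply: eq_bigr => c _; rewrite entry_adj.
rewrite -mulr_suml uxy -natrM mulnb; congr ((nat_of_bool _)%:R).
apply/andP/eqP => [[/eqP[xy1 xy2] /agree_offP xy]|->]; last first.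
  by split=> //; apply/agree_offP.
apply/ffunP => i; have [ip|] := boolP (i \in [:: p.1; p.2]); last exact: xy.
by move: ip; rewrite !inE => /orP[] /eqP ->.
Qed.

Lemma layer_unitary M u : uniq (covered M) ->
  (forall p, p \in M -> u p \is unitarymx) -> layer_op M u \is unitarymx.
Proof.
elim: M => [|p M IH] uM uu.
  by rewrite layer_op_nil; apply: unitary_op; rewrite /adj map_mx1 trmx1 mulmx1.
rewrite layer_op_cons //; move: uM; rewrite covered_cons /= inE negb_or.
move=> /and3P[/andP[p12 _] _ uM]; apply: mul_unitarymx.
  by apply: gate_unitary => //; apply: uu; rewrite inE eqxx.
by apply: IH => // q qM; apply: uu; rewrite inE qM orbT.
Qed.

(** Conjugation proceeds one gate at a time. A gate meeting the current support adds at most one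
    qubit, charged to a qubit of [S] in its pair; the pairs being disjoint, no qubit is charged
    twice. The inclusion is what locates the charged qubit in [S]. *)
Lemma layer_cone M u S A : uniq (covered M) ->
  (forall p, p \in M -> u p \is unitarymx) -> supported S A ->
  exists S', [/\ supported S' (layer_op M u *m A *m adj (layer_op M u)),
    S' \subset S :|: [set i in covered M] &
    (#|S'| <= #|S| + #|S :&: [set i in covered M]|)%N].
Proof.
move=> uM uu SA; elim: M uM uu => [|p M IH] uM uu.
  exists S; rewrite layer_op_nil mul1mx /adj map_mx1 trmx1 mulmx1.
  by split=> //; [exact: finset.subsetUl|exact: leq_addr].
rewrite layer_op_cons //; move: uM; rewrite covered_cons /= inE negb_or.
move=> /and3P[/andP[p12 p1M] p2M uM].
have [|S1 [S1A S1s S1c]] := IH uM.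
  by move=> q qM; apply: uu; rewrite inE qM orbT.
set B := layer_op M u *m A *m adj (layer_op M u) in S1A.
set G := layer_op [:: p] u; have GS := gate_supported p u : supported _ G.
have Gu : G \is unitarymx.
  by apply: gate_unitary => //; apply: uu; rewrite inE eqxx.
have -> : G *m layer_op M u *m A *m adj (G *m layer_op M u) = G *m B *m adj G.
  by rewrite adjM /B !mulmxA.
have covS : [set i in covered M] \subset [set i in [:: p.1, p.2 & covered M]].
  by apply/fintype.subsetP => i; rewrite !inE => ->; rewrite !orbT.
(* A gate disjoint from the support commutes with [B] and cancels against its adjoint. *)
have [dj|ndj] := boolP [disjoint S1 & [set p.1; p.2]].
  exists S1; rewrite -(supported_comm dj S1A GS) -mulmxA unitary_mul_adj //.
  rewrite mulmx1; split=> //.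
    by apply: fintype.subset_trans S1s _; apply: finset.setUS.
  by apply: leq_trans S1c _; rewrite leq_add2l subset_leq_card // finset.setIS.
exists (S1 :|: [set p.1; p.2]); split.
- by apply: supported_mul; [apply: supported_mul|apply: supported_adj];
    apply: supported_sub GS || apply: supported_sub S1A;
    rewrite ?finset.subsetUl ?finset.subsetUr.
- rewrite finset.subUset (fintype.subset_trans S1s) ?finset.setUS //=.
  by apply/fintype.subsetP => i; rewrite !inE => /orP[] ->; rewrite ?orbT.
move: ndj; rewrite -finset.setI_eq0 => /finset.set0Pn[j]; rewrite inE => /andP[jS1 jp].
(* No other gate covers [j], so the inclusion traces it back to [S]; it is a new element of the
   intersection and pays for the added qubit. *)
have jM : j \notin covered M by move: jp; rewrite !inE => /orP[] /eqP ->.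
have jS : j \in S.
  by have := fintype.subsetP S1s j jS1; rewrite !inE (negPf jM) orbF.
have c1 : (#|S1 :|: [set p.1; p.2]| <= #|S1|.+1)%N.
  rewrite cardsU cards2 p12 /=.
  have : (0 < #|S1 :&: [set p.1; p.2]|)%N by apply/card_gt0P; exists j; rewrite inE jS1.
  by case: #|_| => // k _; rewrite addn2 subSS leq_subr.
apply: leq_trans c1 _.
have c2 : (#|S :&: [set i in covered M]| <
           #|S :&: [set i in [:: p.1, p.2 & covered M]]|)%N.
  apply: proper_card; rewrite fintype.properE finset.setIS //=.
  apply/subsetPn; exists j; rewrite !inE jS ?(negPf jM) //=.
  by move: jp; rewrite !inE => /orP[] ->; rewrite ?orbT.
by apply: leq_ltn_trans S1c _; rewrite ltn_add2l.
Qed.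

End Layers.

(** * Light cones of circuits *)

Section Circuits.
Variables (R : rcfType) (n : nat).

Lemma circuit_light_cone (G : rel 'I_n) (Ls : seq 'M[R[i]]_#|qbasis n|) :
  (forall L, L \in Ls -> is_layer G L) ->
  exists U : 'M[R[i]]_#|qbasis n|,
    [/\ U \is unitarymx,
      forall w : 'cV_#|qbasis n|, foldr (fun L w => L *m w) w Ls = U *m w &
      forall S A, supported S A -> exists2 S' : {set 'I_n},
        supported S' (U *m A *m adj U) & (#|S'| <= 2 ^ size Ls * #|S|)%N].
Proof.
elim: Ls => [|L Ls IH] layLs.
  exists 1%:M; have a1 : adj 1%:M = 1%:M :> 'M[R[i]]_#|qbasis n|.
    by rewrite /adj map_mx1 trmx1.
  split=> [|w|S A SA]; first by apply: unitary_op; rewrite a1 mulmx1.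
  - by rewrite mul1mx.
  - by exists S; rewrite ?a1 ?mulmx1 ?mul1mx // mul1n.
have [|U [Uu UE Uc]] := IH.
  by move=> L' L'Ls; apply: layLs; rewrite inE L'Ls orbT.
have [|M [u [uM _ uu LE]]] := layLs L; first by rewrite inE eqxx.
rewrite -/(layer_op M u) in LE.
(* The head of the list is the layer applied last, so it conjugates outermost; by [layer_cone] it at
   most doubles the support. *)
exists (L *m U); split=> [|w|S A SA].
- by apply: mul_unitarymx => //; rewrite LE; apply: layer_unitary.
- by rewrite /= UE mulmxA.
have [S1 S1A S1c] := Uc S A SA.
have [S2 [S2A _ S2c]] := layer_cone uM uu S1A.
exists S2; first by rewrite adjM LE !mulmxA in S2A *.
apply: leq_trans S2c _; rewrite expnS -mulnA mul2n -addnn.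
apply: leq_add => //; apply: leq_trans S1c; apply: subset_leq_card.
exact: finset.subsetIl.
Qed.

End Circuits.

(** Gibbs' inequality against the product of [n] Bernoulli([q]) laws. *)
Lemma min_entropy_le_H2 (R : realType) n k (p : qbasis n -> R) (q : R) :
  (forall x, 0 <= p x) -> (forall x, p x <= (2 ^+ k)^-1) -> \sum_x p x = 1 ->
  0 <= q -> q < 2^-1 -> (forall i, \sum_(x : qbasis n | x i) p x <= q) ->
  k%:R <= n%:R * H2 q.
Proof.
move=> p0 pk p1 q0 qh pq.
have ln2 : 0 < ln 2 :> R by rewrite ln_gt0 // ltr1n.
(* The Bernoulli law degenerates at [q = 0], which is treated apart: all mass then sits on the zero
   string, and the cap on [p] forces [k = 0]. *)
move: q0; rewrite le_eqVlt => /predU1P[q0|q0].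
  have pz (x : qbasis n) : x != [ffun => false] -> p x = 0.
    move=> xN; have [i xi] : exists i, x i.
      case: (pickP x) => [i xi|x0]; first by exists i.
      by case/eqP: xN; apply/ffunP => i; rewrite ffunE x0.
    apply/le_anti; rewrite p0 andbT q0; apply: le_trans (pq i).
    by rewrite (bigD1 x) //= lerDl sumr_ge0.
  move: p1; rewrite (bigD1 [ffun => false]) //= [X in _ + X]big1 // addr0 => p1.
  have := pk [ffun => false]; rewrite p1 -[leLHS]invr1 lef_pV2 ?posrE ?exprn_gt0 //.
  rewrite -natrX -[1]/(1%:R) ler_nat -[X in (_ <= X)%N](expn0 2) leq_exp2l // leqn0.
  by move=> /eqP ->; rewrite -q0 /H2 /log2 subr0 ln1 oppr0 !mul0r mulr0 subr0 mulr0.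
have q1 : 0 < 1 - q by lra.
pose r (x : qbasis n) : R := \prod_i (if x i then q else 1 - q).
have r_gt0 x : 0 < r x by apply: prodr_gt0 => i _; case: ifP.
have r1 : \sum_x r x = 1.
  rewrite /r -(bigA_distr_bigA (fun (i : 'I_n) (b : bool) => if b then q else 1 - q)).
  by rewrite big1 // => i _; rewrite big_bool /= addrC subrK.
have lnr x : ln (r x) = \sum_i (if x i then ln q else ln (1 - q)).
  suff [] : 0 < r x /\ ln (r x) = \sum_i (if x i then ln q else ln (1 - q)) by [].
  rewrite /r; elim/big_rec2: _ => [|i z y _ [y0 yz]]; first by rewrite ln1.
  have b0 : 0 < if x i then q else 1 - q by case: ifP.
  by rewrite mulr_gt0 // lnM ?posrE // yz; case: ifP.
(* Weighted by [p], the bound [ln (r / p) <= r / p - 1] sums to at most 0, both laws having mass 1;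
   the cap on [p] gives [ln p <= - k ln 2]. *)
have gibbs : \sum_x p x * ln (r x) <= - (k%:R * ln 2).
  have: \sum_x p x * (ln (r x) + k%:R * ln 2) <= \sum_x (r x - p x).
    apply: ler_sum => x _; have := p0 x; rewrite le_eqVlt => /predU1P[<-|px].
      by rewrite mul0r subr0 ltW.
    have lnp : ln (p x) <= - (k%:R * ln 2).
      have := pk x; rewrite -ler_ln ?posrE ?invr_gt0 ?exprn_gt0 //.
      by rewrite lnV ?posrE ?exprn_gt0 // lnXn // mulr_natl.
    have := @le_ln1Dx R (r x / p x - 1).
    rewrite addrCA subrr addr0 ltrBrDl subrr divr_gt0 // ln_div ?posrE // => /(_ isT) h.
    have {}h : p x * (ln (r x) + k%:R * ln 2) <= p x * (r x / p x - 1).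
      by rewrite ler_pM2l //; lra.
    by apply: le_trans h _; rewrite mulrBr mulr1 mulrCA divff ?mulr1 // gt_eqF.
  rewrite sumrB r1 p1 subrr; under eq_bigr => x _ do rewrite mulrDr.
  by rewrite big_split -mulr_suml p1 mul1r /=; lra.
(* As [q < 1/2] gives [ln q <= ln (1 - q)], the contribution of a bit does not increase with its
   marginal, so among marginals up to [q] it is least at [q]. *)
have marg : n%:R * (q * ln q + (1 - q) * ln (1 - q)) <= \sum_x p x * ln (r x).
  under eq_bigr => x _ do rewrite lnr mulr_sumr.
  rewrite exchange_big /= mulr_natl -[X in _ *+ X]card_ord -sumr_const.
  apply: ler_sum => i _.
  have -> : \sum_(x : qbasis n) p x * (if x i then ln q else ln (1 - q)) =
      \sum_(x : qbasis n | x i) p x * (ln q - ln (1 - q)) + ln (1 - q).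
    have pE : \sum_x p x * ln (1 - q) = ln (1 - q) by rewrite -mulr_suml p1 mul1r.
    rewrite -[X in _ = _ + X]pE [X in _ = X + _]big_mkcond -big_split /=.
    by apply: eq_bigr => x _; case: (x i); ring.
  rewrite -mulr_suml.
  have := pq i; set s := \sum_(x | _) _ => sq.
  have : ln q <= ln (1 - q) by rewrite ler_ln ?posrE //; lra.
  by nra.
rewrite -(ler_pM2r ln2) /H2 /log2.
have -> : n%:R * (- q * (ln q / ln 2) - (1 - q) * (ln (1 - q) / ln 2)) * ln 2 =
    - (n%:R * (q * ln q + (1 - q) * ln (1 - q))).
  by field; rewrite gt_eqF.
by lra.
Qed.

(** * Real parts, Pauli Z observables and projectors *)

Section ComplexRe.
Variable R : rcfType.

Lemma ReD (x y : R[i]) : complex.Re (x + y) = complex.Re x + complex.Re y.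
Proof. by case: x y => a b [c e]. Qed.

Lemma Re_sum (I : finType) (F : I -> R[i]) :
  complex.Re (\sum_i F i) = \sum_i complex.Re (F i).
Proof. by apply: (big_morph _ ReD). Qed.

Lemma ReMl (a : R) (x : R[i]) : complex.Re (real_complex R a * x) = a * complex.Re x.
Proof. by case: x => b c /=; rewrite mul0r subr0. Qed.

Lemma ReMr (a : R) (x : R[i]) : complex.Re (x * real_complex R a) = complex.Re x * a.
Proof. by rewrite mulrC ReMl mulrC. Qed.

End ComplexRe.

Section PauliZ.
Variables (C : numClosedFieldType) (n : nat) (i : 'I_n).

Definition pauliZ : 'M[C]_#|qbasis n| :=
  mkop (fun x y : qbasis n => (x == y)%:R * (-1) ^+ (x i)).

Lemma pauliZ_unitary : pauliZ \is unitarymx.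
Proof.
apply: unitary_op; apply: op_eqP => x y; rewrite entry_mul entry1 (bigD1 x) //=.
rewrite big1 ?addr0 => [|z zx].
  rewrite entry_adj !entry_mkop eqxx mul1r rmorph_sign mulrCA -expr2 sqrr_sign.
  by rewrite mulr1.
by rewrite entry_adj !entry_mkop (negPf zx) mul0r conjC0 mul0r.
Qed.

Lemma pauliZ_supported : supported [set i] pauliZ.
Proof.
split=> [x y j ji xy|x y s si]; rewrite !entry_mkop.
  by case: eqP => [xyE|_]; [rewrite xyE eqxx in xy|rewrite mul0r].
by rewrite (inj_eq (bij_inj (bxor_bij s))) ffunE si ?inE // addbF.
Qed.

Lemma trace_mul_pauliZ (A : 'M[C]_#|qbasis n|) :
  \tr (A *m pauliZ) = \sum_(x : qbasis n) entry A x x * (-1) ^+ (x i).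
Proof.
rewrite mxtrace_entry; apply: eq_bigr => x _; rewrite entry_mul (bigD1 x) //=.
rewrite big1 ?addr0 ?entry_mkop ?eqxx ?mul1r // => z zx.
by rewrite entry_mkop (negPf zx) mul0r mulr0.
Qed.

End PauliZ.

(** A diagonal entry of a Hermitian idempotent is the squared norm of its row, hence at least its
    own square. *)
Lemma projector_diag (C : numClosedFieldType) m (Q : 'M[C]_m) (i : 'I_m) :
  adj Q = Q -> Q *m Q = Q -> 0 <= Q i i <= 1.
Proof.
move=> Qh QQ.
have QE : Q i i = \sum_j `|Q i j| ^+ 2 by rewrite -mul_adj_diag Qh QQ.
have Q0 : 0 <= Q i i by rewrite QE sumr_ge0 // => j _; rewrite exprn_ge0.
have : Q i i ^+ 2 <= Q i i.
  by rewrite [leRHS]QE (bigD1 i) //= ger0_norm // lerDl sumr_ge0.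
rewrite Q0 /=; move: Q0; rewrite le_eqVlt => /predU1P[<-|Qp]; first by rewrite ler01.
by rewrite expr2 ger_pMl.
Qed.

(** * Boundedness of the set defining the subsystem variance *)

Section Bounds.
Variable (C : numClosedFieldType).

Lemma ptrace_entry_le n (S : {set 'I_n}) (rho : 'M[C]_#|qbasis n|) i j :
  `|ptrace S rho i j| <= \sum_x \sum_y `|entry rho x y|.
Proof.
rewrite mxE; apply: le_trans (ler_norm_sum _ _ _) _.
rewrite [leRHS](bigID (fun x => Defs.restrict S x == enum_val i)) /=.
rewrite ler_wpDr //; first by apply: sumr_ge0 => x _; apply: sumr_ge0.
apply: ler_sum => x _; apply: le_trans (ler_norm_sum _ _ _) _.
rewrite [leRHS](bigID (fun y => (Defs.restrict S y == enum_val j) &&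
  [forall k, (k \notin S) ==> (x k == y k)])) /=.
by rewrite ler_wpDr // sumr_ge0.
Qed.

Lemma unit_vec_entry_le m (v : 'cV[C]_m) i : unit_vec v -> `|v i 0| <= 1.
Proof.
rewrite /unit_vec adj_mul_diag (bigD1 i) //= => vE.
by rewrite -(@expr_le1 _ 2) // -vE lerDl sumr_ge0.
Qed.

End Bounds.

Section Variance.
Variables (R : realType) (n k d : nat) (Pi : 'M[R[i]]_#|qbasis n|).

(** [sup] is known to dominate a set only if the set is bounded above, so some constant uniform in
    [psi] and [S] is required. *)
Lemma trnorm_reduced_bounded : exists K : R,
  forall (psi : 'cV[R[i]]_#|qbasis n|) (S : {set 'I_n}), unit_vec psi ->
    trnorm (ptrace S (dens psi) - ptrace S (Gamma k Pi)) <= K.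
Proof.
pose N : R[i] := #|qbasis n|%:R.
(* The entries of [dens psi] have modulus at most 1, so their moduli sum to at most [N * N], and [K]
   bounds each entry of the difference of partial traces. *)
pose K : R[i] := N * N + \sum_x \sum_y `|entry (Gamma k Pi) x y|.
have N0 : 0 <= N by apply: ler0n.
have K0 : 0 <= K.
  by apply: addr_ge0; rewrite ?mulr_ge0 // sumr_ge0 // => x _; rewrite sumr_ge0.
exists (complex.Re (N + N * (N * K ^+ 2))) => psi S psi1.
apply: le_trans (trnorm_le_sum _) _.
suff: #|subbasis S|%:R + \sum_i \sum_j
    `|(ptrace S (dens psi) - ptrace S (Gamma k Pi)) i j| ^+ 2 <=
    N + N * (N * K ^+ 2) by rewrite lecE => /andP[].
have cS : #|subbasis S|%:R <= N.
  by rewrite ler_nat (leq_card _ (can_inj (@restrict_extend n S))).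
have K20 : 0 <= K ^+ 2 by rewrite exprn_ge0.
have sum_le (F : 'I_#|subbasis S| -> R[i]) (B : R[i]) :
    0 <= B -> (forall i, F i <= B) -> \sum_i F i <= N * B.
  move=> B0 FB; apply: (@le_trans _ _ (\sum_(i < #|subbasis S|) B)).
    exact: ler_sum.
  by rewrite sumr_const card_ord -mulr_natl ler_wpM2r.
apply: lerD => //; apply: (sum_le) => [|i]; first exact: mulr_ge0.
apply: (sum_le) => // j; rewrite lerXn2r ?nnegrE //.
have -> : (ptrace S (dens psi) - ptrace S (Gamma k Pi)) i j =
    ptrace S (dens psi) i j - ptrace S (Gamma k Pi) i j by rewrite !mxE.
apply: le_trans (ler_normB _ _) _; apply: lerD; last exact: ptrace_entry_le.
apply: le_trans (ptrace_entry_le _ _ _) _.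
have -> : N * N = \sum_(x : qbasis n) \sum_(y : qbasis n) 1.
  by rewrite !sumr_const -mulr_natl.
apply: ler_sum => x _; apply: ler_sum => y _.
rewrite /entry /dens mxE big_ord1 !mxE normrM norm_conjC.
by rewrite mulr_ile1 // unit_vec_entry_le.
Qed.

(** Makes every light cone of at most [d] qubits eligible in the variance. *)
Lemma complete_connected (S : {set 'I_n}) : connected_in (complete_graph n) S.
Proof.
move=> x y xS yS; have [->|xy] := eqVneq x y; first exact: connect0.
by apply: connect1; rewrite /= /complete_graph xy xS.
Qed.

Lemma trnorm_le_variance (psi : 'cV[R[i]]_#|qbasis n|) (S : {set 'I_n}) :
  unit_vec psi -> in_code Pi psi -> (#|S| <= d)%N ->
  trnorm (ptrace S (dens psi) - ptrace S (Gamma k Pi)) <=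
    subsystem_variance k (complete_graph n) Pi d.
Proof.
move=> psi1 psiC Sd; apply: ub_le_sup.
  have [K HK] := trnorm_reduced_bounded; exists K => _ [phi [T [phi1 _ _ _ ->]]].
  exact: HK.
by exists psi, S; split=> //; exact: complete_connected.
Qed.

End Variance.

(** * Bias of each bit under a shallow circuit *)

Section Core.
Variables (R : realType) (n k d : nat) (delta : R) (Pi : 'M[R[i]]_#|qbasis n|).

Let eps := subsystem_variance k (complete_graph n) Pi d.

Lemma trace_dens_ket0_pauliZ (i : 'I_n) :
  \tr (dens (@ket0 R n) *m pauliZ _ i) = 1.
Proof.
have dE x : entry (dens (@ket0 R n)) x x = (x == [ffun => false])%:R.
  rewrite /entry /dens mxE big_ord1 !mxE enum_rankK.
  by case: eqP => _; rewrite ?conjC1 ?mulr1 ?mul0r.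
rewrite trace_mul_pauliZ (bigD1 [ffun => false]) //= dE eqxx ffunE expr0 mulr1.
by rewrite big1 ?addr0 // => x xN; rewrite dE (negPf xN) mul0r.
Qed.

(** The bias starts at 1 for the circuit output, loses at most [delta] in passing to [psi], and at
    most [eps] in passing on to [Gamma], the second loss being measured on [S] alone. *)
Lemma low_depth_bias (U : 'M[R[i]]_#|qbasis n|) (S : {set 'I_n}) i
    (psi : 'cV[R[i]]_#|qbasis n|) :
  U \is unitarymx -> supported S (U *m pauliZ _ i *m adj U) -> (#|S| <= d)%N ->
  unit_vec psi -> in_code Pi psi ->
  trnorm (dens (U *m ket0 n) - dens psi) <= delta ->
  1 - (eps + delta) <= complex.Re (\tr (adj U *m Gamma k Pi *m U *m pauliZ _ i)).
Proof.
move=> Uu SW Sd psi1 psiC near; set W := U *m _ *m _ in SW.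
have Wu : W \is unitarymx.
  by rewrite !mul_unitarymx ?pauliZ_unitary ?adj_unitary.
have wW : \tr (dens (U *m ket0 n) *m W) = 1.
  rewrite -(trace_dens_ket0_pauliZ i) mxtrace_mulC /dens adjM /W.
  rewrite !mulmxA -[U *m _ *m _ *m U]mulmxA (unitary_adj_mul Uu) mulmx1.
  rewrite mxtrace_mulC !mulmxA (unitary_adj_mul Uu) mul1mx.
  by rewrite -!mulmxA mxtrace_mulC !mulmxA.
have GW : \tr (adj U *m Gamma k Pi *m U *m pauliZ _ i) = \tr (Gamma k Pi *m W).
  by rewrite -!mulmxA mxtrace_mulC /W !mulmxA.
have h1 := Re_trace_le_trnorm (dens (U *m ket0 n) - dens psi) Wu.
have h2 := Re_trace_le_trnorm (ptrace S (dens psi) - ptrace S (Gamma k Pi))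
  (reduce_unitary SW Wu).
have h3 := trnorm_le_variance k psi1 psiC Sd : _ <= eps.
move: h1 h2; rewrite !mulmxBl !raddfB /= !trace_ptrace // wW -GW.
move=> /ler_normlP[_ h1] /ler_normlP[_ h2].
by move: h1 h2 => /=; lra.
Qed.

End Core.

(** * Measuring the rotated code state in the computational basis *)

Section Marginals.
Variables (R : realType) (n k : nat) (Pi U : 'M[R[i]]_#|qbasis n|).
Hypotheses (codePi : code_projector k Pi) (Uu : U \is unitarymx).

Definition outcome_prob (x : qbasis n) : R :=
  complex.Re (entry (adj U *m Gamma k Pi *m U) x x).

Lemma outcome_probE x :
  outcome_prob x = (2 ^+ k)^-1 * complex.Re (entry (adj U *m Pi *m U) x x).
Proof.
rewrite /outcome_prob /Gamma -scalemxAr -scalemxAl /entry mxE natrX.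
have -> : ((2 : R[i]) ^+ k)^-1 = real_complex R (2 ^+ k)^-1.
  by rewrite fmorphV rmorphXn /= rmorph_nat.
by rewrite ReMl.
Qed.

(** A unitary conjugate of a projector is again a projector. *)
Lemma rotated_code_diag x :
  0 <= complex.Re (entry (adj U *m Pi *m U) x x) <= 1.
Proof.
case: codePi => Ph PP _; set Q := adj U *m Pi *m U.
have Qh : adj Q = Q by rewrite !adjM adjK Ph mulmxA.
have QQ : Q *m Q = Q.
  by rewrite /Q -!mulmxA (mulmxA U) unitary_mul_adj // mul1mx (mulmxA Pi) PP.
have := projector_diag (enum_rank x) Qh QQ.
by rewrite !lecE => /andP[/andP[_ ->] /andP[_ ->]].
Qed.

Lemma outcome_prob_ge0 x : 0 <= outcome_prob x.
Proof.
rewrite outcome_probE mulr_ge0 ?invr_ge0 ?exprn_ge0 //.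
by case/andP: (rotated_code_diag x).
Qed.

Lemma outcome_prob_le x : outcome_prob x <= (2 ^+ k)^-1.
Proof.
rewrite outcome_probE ler_piMr ?invr_ge0 ?exprn_ge0 //.
by case/andP: (rotated_code_diag x).
Qed.

Lemma outcome_prob_sum : \sum_x outcome_prob x = 1.
Proof.
case: codePi => _ PP rkP.
rewrite /outcome_prob -Re_sum -mxtrace_entry mxtrace_mulC mulmxA.
by rewrite unitary_mul_adj // mul1mx mxtraceZ (mxtrace_idempotent PP) rkP mulVf //.
Qed.

(** The sign attached to a bit is 1 minus twice its value, so the expectation of Z encodes the
    marginal. *)
Lemma outcome_prob_pauliZ i :
  complex.Re (\tr (adj U *m Gamma k Pi *m U *m pauliZ _ i)) =
  1 - 2 * \sum_(x : qbasis n | x i) outcome_prob x.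
Proof.
rewrite trace_mul_pauliZ Re_sum -[X in _ = X - _]outcome_prob_sum mulr_sumr.
rewrite [X in _ = _ - X]big_mkcond -sumrB; apply: eq_bigr => x _.
rewrite -(rmorph_sign (real_complex R)) ReMr -/(outcome_prob x).
by case: (x i); rewrite /= ?expr1 ?expr0; ring.
Qed.

End Marginals.

(** * From circuit depth to robust complexity *)

Section Core.
Variables (R : realType) (n k d : nat) (delta : R) (Pi : 'M[R[i]]_#|qbasis n|).

Let eps := subsystem_variance k (complete_graph n) Pi d.

Lemma depth_lower_bound (G : rel 'I_n) (l : nat) (psi v : 'cV[R[i]]_#|qbasis n|) :
  (0 < n)%N -> code_projector k Pi -> eps + delta < 1 ->
  H2 (eps / 2 + delta / 2) < k%:R / n%:R ->
  unit_vec psi -> in_code Pi psi -> reachable G l v ->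
  trnorm (dens v - dens psi) <= delta -> (d < 2 ^ l)%N.
Proof.
move=> n0 codePi q1 Hq psi1 psiC [Ls [sz lay ->]] near; rewrite ltnNge -sz.
apply/negP => ld; have [U [Uu UE Uc]] := circuit_light_cone lay.
rewrite UE in near.
have marg i : \sum_(x : qbasis n | x i) outcome_prob k Pi U x <= eps / 2 + delta / 2.
  have [S SW Sc] := Uc _ _ (pauliZ_supported _ i).
  rewrite cards1 muln1 in Sc.
  have := low_depth_bias k Uu SW (leq_trans Sc ld) psi1 psiC near.
  by rewrite outcome_prob_pauliZ // -/eps; lra.
(* Nonnegativity is read off the marginal of the first qubit, which exists because [0 < n]. *)
have q0 : 0 <= eps / 2 + delta / 2.
  apply: le_trans (marg (Ordinal n0)).
  by apply: sumr_ge0 => x _; exact: outcome_prob_ge0.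
have qh : eps / 2 + delta / 2 < 2^-1 by lra.
have := min_entropy_le_H2 (outcome_prob_ge0 codePi Uu)
  (outcome_prob_le codePi Uu) (outcome_prob_sum codePi Uu) q0 qh marg.
by rewrite leNgt mulrC -ltr_pdivlMr ?ltr0n // Hq.
Qed.

End Core.

Theorem theorem1 (R : realType) (n k d : nat) (delta : R)
  (Pi : 'M[R[i]]_#|qbasis n|) :
  (k < n)%N -> code_projector k Pi -> (1 <= d)%N -> 0 <= delta ->
  subsystem_variance k (complete_graph n) Pi d + delta < 1 ->
  H2 (subsystem_variance k (complete_graph n) Pi d / 2 + delta / 2)
    < k%:R / n%:R ->
  forall psi : 'cV[R[i]]_#|qbasis n|, unit_vec psi -> in_code Pi psi ->
  ((log2 (d%:R : R))%:E < robust_complexity (complete_graph n) delta (dens psi))%E.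
Proof.
move=> kn codePi d1 delta0 q1 Hq psi psi1 psiC.
have ln2 : 0 < ln 2 :> R by rewrite ln_gt0 // ltr1n.
(* Passing to an infimum keeps only weak bounds, so strictness is secured first, at the least
   integer above [log d]. *)
apply: (@lt_le_trans _ _ ((trunc_log 2 d).+1%:R)%:E).
  rewrite lte_fin /log2 ltr_pdivrMr // mulr_natl -lnXn // -natrX.
  by rewrite ltr_ln ?posrE ?ltr0n ?expn_gt0 // ltr_nat trunc_log_ltn.
apply: le_ereal_inf_tmp => _ [v [v1 near ->]].
(* The circuit output [w] may differ from [v] as a vector; only the density matrices agree. *)
apply: le_ereal_inf_tmp => _ [l [w [vw [wl ->]]]]; rewrite vw in near.
rewrite lee_fin ler_nat.
(* [2 ^ trunc_log 2 d <= d < 2 ^ l] forces [trunc_log 2 d < l]. *)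
rewrite -(@ltn_exp2l 2) //; apply: leq_ltn_trans (trunc_logP _ d1) _ => //.
exact: depth_lower_bound (leq_ltn_trans (leq0n k) kn) codePi q1 Hq psi1 psiC wl near.
Qed.
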